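(* For every $n \in \mathbb{N}$, the monoid $UT_n(\mathbb{Z}_{\max})$ is finitely presented by the monoid presentation $\langle \Omega_n \mid R_n' \rangle$.
   Context: $\mathbb{N}$ is the set of positive integers. $\mathbb{Z}_{\max} = \mathbb{Z}\cup\{-\infty\}$ is the tropical integer semiring, with semiring addition $\max$ and semiring multiplication the usual addition (zero $-\infty$, one $0$). $UT_n(\mathbb{Z}_{\max})$ is the monoid, under (tropical) matrix multiplication, of $n\times n$ matrices over $\mathbb{Z}_{\max}$ with all entries below the diagonal equal to $-\infty$. For an alphabet $\Sigma$, $\Sigma^*$ is the free monoid on $\Sigma$, with empty word $\varepsilon$. For $R\subseteq \Sigma^*\times\Sigma^*$, a monoid $\mathcal{S}$ is presented by $\langle \Sigma\mid R\rangle$ if $\mathcal{S}\cong\Sigma^*/\rho_R$, where $\rho_R$ is the smallest congruence on $\Sigma^*$ containing $R$; it is finitely presented by $\langle \Sigma\mid R\rangle$ if moreover $\Sigma$ and $R$ are finite. A pair $(u,v)\in R$ is written $u=v$. $\Omega_n = \{a_k, a_k^{-1}, c_k, d_{ij} : 1\le k\le n,\ 1\le i<j\le n\}$ is an alphabet (here $a_k^{-1}$ is a formal letter). $R_n'$ is the set of all the following relations, where $1\le i<j\le n$, $1\le k,l\le n$, and also $1 \le s<t\le n$ in (C8) and $1 \le t\le n$ in (C9): (C1) $a_ia_j=a_ja_i$; (C2) $c_ic_j=c_jc_i$; (C3) $c_k^2=c_k$; (C4) $d_{ij}^2=d_{ij}$; (C5) $a_lc_k=c_ka_l$; (C6) $a_kd_{ij}=d_{ij}a_k$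 for $k\ne i,j$; (C7) $c_kd_{ij}=d_{ij}c_k$ for $k\neq i,j$; (C8) $d_{ij}d_{st}=d_{st}d_{ij}$ for $j\ne s<t\ne i$; (C9) $d_{ij}d_{jt}=d_{jt}d_{ij}d_{it}$ for $j<t$; (C10) $d_{ij}a_id_{ij}=a_id_{ij}$; (C11) $d_{ij}a_jd_{ij}=d_{ij}a_j$; (C12) $a_ia_jd_{ij}=d_{ij}a_ia_j$; (Z1) $a_kc_k=c_k$; (Z2) $c_id_{ij}=c_i$; (Z3) $d_{ij}c_j=c_j$; (I1) $a_ka_k^{-1}=\varepsilon$; (I2) $a_k^{-1}a_k=\varepsilon$. *)

(* Defs.v *)
From HB Require Import structures.
From mathcomp Require Import all_boot all_order all_algebra.
From mathcomp Require Import boolp classical_sets cardinality.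

Set Implicit Arguments.
Unset Strict Implicit.
Unset Printing Implicit Defensive.

Import Order.TTheory GRing.Theory Num.Theory.

(* [None] stands for -oo.  In the semiring structure below, [+], [*], [0], [1]
   in ring_scope are max, integer addition, -oo and the integer 0. *)
Definition Zmax : Type := option int.

HB.instance Definition _ := Choice.on Zmax.

Section ZmaxSemiring.
Local Open Scope ring_scope.

Definition zmax_add (x y : Zmax) : Zmax :=
  match x, y with
  | None, _ => y
  | _, None => x
  | Some a, Some b => Some (Num.max a b)
  end.

Definition zmax_mul (x y : Zmax) : Zmax :=
  match x, y with
  | Some a, Some b => Some (a + b)
  | _, _ => None
  end.

Lemma zmax_addA : associative zmax_add.
Proof. by move=> [a|] [b|] [c|] //=; rewrite maxA. Qed.

Lemma zmax_addC : commutative zmax_add.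
Proof. by move=> [a|] [b|] //=; rewrite maxC. Qed.

Lemma zmax_add0 : left_id None zmax_add.
Proof. by []. Qed.

Lemma zmax_mulA : associative zmax_mul.
Proof. by move=> [a|] [b|] [c|] //=; rewrite addrA. Qed.

Lemma zmax_mulC : commutative zmax_mul.
Proof. by move=> [a|] [b|] //=; rewrite addrC. Qed.

Lemma zmax_mul1 : left_id (Some 0) zmax_mul.
Proof. by move=> [a|] //=; rewrite add0r. Qed.

Lemma zmax_mulDl : left_distributive zmax_mul zmax_add.
Proof. by move=> [a|] [b|] [c|] //=; rewrite addr_maxl. Qed.

Lemma zmax_mul0 : left_zero None zmax_mul.
Proof. by []. Qed.

End ZmaxSemiring.

HB.instance Definition _ :=
  GRing.isNmodule.Build Zmax zmax_addA zmax_addC zmax_add0.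
HB.instance Definition _ :=
  GRing.Nmodule_isComNzSemiRing.Build Zmax
    zmax_mulA zmax_mulC zmax_mul1 zmax_mulDl zmax_mul0 isT.

Section UpperTriangular.
Local Open Scope ring_scope.
Variables (S : pzSemiRingType) (n : nat).

Definition upper_trig (A : 'M[S]_n) : bool :=
  [forall i : 'I_n, forall j : 'I_n, (j < i)%N ==> (A i j == 0)].

Lemma upper_trigP (A : 'M[S]_n) :
  reflect (forall i j : 'I_n, (j < i)%N -> A i j = 0) (upper_trig A).
Proof.
apply: (iffP forallP) => [H i j lt_ji | H i].
  by apply/eqP; move: (H i) => /forallP/(_ j)/implyP; apply.
by apply/forallP => j; apply/implyP => lt_ji; apply/eqP/H.
Qed.

Record UT : Type := MkUT { UTval :> 'M[S]_n; UT_upper : upper_trig UTval }.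

HB.instance Definition _ := [isSub for UTval].
HB.instance Definition _ := [Choice of UT by <:].

Lemma upper_trig_mul (A B : UT) : upper_trig (UTval A *m UTval B).
Proof.
apply/upper_trigP => i j lt_ji; rewrite mxE big1 // => k _.
case: (ltnP k i) => [lt_ki | le_ik].
  by rewrite (upper_trigP _ (UT_upper A)) // mul0r.
by rewrite (upper_trigP _ (UT_upper B)) ?mulr0 // (leq_trans lt_ji).
Qed.

Lemma upper_trig_one : upper_trig (1%:M : 'M[S]_n).
Proof.
apply/upper_trigP => i j lt_ji; rewrite mxE; case: eqP => // eq_ij.
by rewrite eq_ij ltnn in lt_ji.
Qed.

Definition UT_mul (A B : UT) : UT := MkUT (upper_trig_mul A B).
Definition UT_one : UT := MkUT upper_trig_one.

Lemma UT_mulA : associative UT_mul.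
Proof. by move=> A B C; apply: val_inj; rewrite /= mulmxA. Qed.

Lemma UT_mul1 : left_id UT_one UT_mul.
Proof. by move=> A; apply: val_inj; rewrite /= mul1mx. Qed.

Lemma UT_mulr1 : right_id UT_one UT_mul.
Proof. by move=> A; apply: val_inj; rewrite /= mulmx1. Qed.

HB.instance Definition _ := isMonoid.Build UT UT_mulA UT_mul1 UT_mulr1.

End UpperTriangular.

Section Presentation.
Local Open Scope classical_set_scope.
Local Open Scope quotient_scope.
Variables (A : choiceType) (R : set (seq A * seq A)).

Definition congruence (rho : seq A -> seq A -> Prop) : Prop :=
  [/\ forall u, rho u u,
      forall u v, rho u v -> rho v u,
      forall u v w, rho u v -> rho v w -> rho u w
    & forall u u' v v', rho u u' -> rho v v' -> rho (u ++ v) (u' ++ v')].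

(* The intersection of all congruences containing R. *)
Definition gen_congr (u v : seq A) : Prop :=
  forall rho, congruence rho -> (forall p, R p -> rho p.1 p.2) -> rho u v.

Lemma gen_congrP : congruence gen_congr.
Proof.
split=> [u|u v uv|u v w uv vw|u u' v v' uu' vv'] rho rhoP rhoR;
  have [rf sym tr cat] := rhoP.
- exact: rf.
- exact: sym (uv _ rhoP rhoR).
- exact: tr (uv _ rhoP rhoR) (vw _ rhoP rhoR).
- exact: cat (uu' _ rhoP rhoR) (vv' _ rhoP rhoR).
Qed.

Lemma gen_congr_sub p : R p -> gen_congr p.1 p.2.
Proof. by move=> Rp rho _; apply. Qed.

Definition gen_rel : rel (seq A) := fun u v => `[< gen_congr u v >].

Lemma gen_rel_refl : reflexive gen_rel.
Proof. by move=> u; apply/asboolP; have [rf _ _ _] := gen_congrP. Qed.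

Lemma gen_rel_sym : symmetric gen_rel.
Proof.
have [_ sym _ _] := gen_congrP.
by move=> u v; apply/asboolP/asboolP; apply: sym.
Qed.

Lemma gen_rel_trans : transitive gen_rel.
Proof.
have [_ _ tr _] := gen_congrP.
move=> v u w /asboolP uv /asboolP vw; apply/asboolP; exact: tr uv vw.
Qed.

Canonical gen_equiv := EquivRel gen_rel gen_rel_refl gen_rel_sym gen_rel_trans.

Definition pres_monoid : Type := {eq_quot gen_equiv}.

HB.instance Definition _ := Choice.on pres_monoid.
HB.instance Definition _ := EqQuotient.on pres_monoid.

Lemma pres_piP (u v : seq A) :
  \pi_pres_monoid u = \pi_pres_monoid v <-> gen_congr u v.
Proof.
split; first by move=> /eqmodP/asboolP.
by move=> uv; apply/eqmodP/asboolP.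
Qed.

Definition pres_mul (x y : pres_monoid) : pres_monoid :=
  \pi_pres_monoid (repr x ++ repr y).

Definition pres_one : pres_monoid := \pi_pres_monoid [::].

Lemma pres_pi_cat (u v : seq A) :
  \pi_pres_monoid (u ++ v) = pres_mul (\pi_pres_monoid u) (\pi_pres_monoid v).
Proof.
have [_ _ _ cat] := gen_congrP.
by apply/pres_piP; apply: cat; apply/pres_piP; rewrite reprK.
Qed.

Lemma pres_mulA : associative pres_mul.
Proof.
move=> x y z; rewrite -[x]reprK -[y]reprK -[z]reprK.
rewrite -(pres_pi_cat (repr y)) -(pres_pi_cat (repr x) (repr y)).
by rewrite -2!pres_pi_cat catA.
Qed.

Lemma pres_mul1 : left_id pres_one pres_mul.
Proof. by move=> x; rewrite -[x]reprK -pres_pi_cat. Qed.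

Lemma pres_mulr1 : right_id pres_one pres_mul.
Proof. by move=> x; rewrite -[x]reprK -pres_pi_cat cats0. Qed.

HB.instance Definition _ :=
  isMonoid.Build pres_monoid pres_mulA pres_mul1 pres_mulr1.

Definition presented_by (M : monoidType) : Prop :=
  exists2 f : M -> pres_monoid, monoid.monoid_morphism f & bijective f.

Definition finitely_presented_by (M : monoidType) : Prop :=
  [/\ presented_by M, finite_set [set: A] & finite_set R].

End Presentation.

(* Indices range over {0, ..., n-1} instead of {1, ..., n}; [Lainv k] is a letter
   with no built-in relation to [La k]. *)
Inductive Omega (n : nat) : Type :=
  | La (k : 'I_n)
  | Lainv (k : 'I_n)
  | Lc (k : 'I_n)
  | Ld (i j : 'I_n) (lt_ij : (i < j)%N).

Arguments La {n} k.
Arguments Lainv {n} k.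
Arguments Lc {n} k.
Arguments Ld {n i j} lt_ij.

Section OmegaFinite.
Variable n : nat.

Definition Omega_code : Type :=
  'I_n + 'I_n + 'I_n + {p : 'I_n * 'I_n | (p.1 < p.2)%N}.

Definition Omega_encode (x : Omega n) : Omega_code :=
  match x with
  | La k => inl (inl (inl k))
  | Lainv k => inl (inl (inr k))
  | Lc k => inl (inr k)
  | @Ld _ i j lt_ij => inr (exist _ (i, j) lt_ij)
  end.

Definition Omega_decode (x : Omega_code) : Omega n :=
  match x with
  | inl (inl (inl k)) => La k
  | inl (inl (inr k)) => Lainv k
  | inl (inr k) => Lc k
  | inr (exist _ lt_ij) => Ld lt_ij
  end.

Lemma Omega_encodeK : cancel Omega_encode Omega_decode.
Proof. by case. Qed.

HB.instance Definition _ := Finite.copy (Omega n) (can_type Omega_encodeK).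

End OmegaFinite.

Section Relations.
Variable n : nat.
Implicit Types i j k l s t : 'I_n.

Inductive R'_rel : seq (Omega n) -> seq (Omega n) -> Prop :=
  | C1 i j : (i < j)%N -> R'_rel [:: La i; La j] [:: La j; La i]
  | C2 i j : (i < j)%N -> R'_rel [:: Lc i; Lc j] [:: Lc j; Lc i]
  | C3 k : R'_rel [:: Lc k; Lc k] [:: Lc k]
  | C4 i j (ij : (i < j)%N) : R'_rel [:: Ld ij; Ld ij] [:: Ld ij]
  | C5 k l : R'_rel [:: La l; Lc k] [:: Lc k; La l]
  | C6 i j k (ij : (i < j)%N) : k <> i -> k <> j ->
      R'_rel [:: La k; Ld ij] [:: Ld ij; La k]
  | C7 i j k (ij : (i < j)%N) : k <> i -> k <> j ->
      R'_rel [:: Lc k; Ld ij] [:: Ld ij; Lc k]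
  | C8 i j s t (ij : (i < j)%N) (st : (s < t)%N) : j <> s -> t <> i ->
      R'_rel [:: Ld ij; Ld st] [:: Ld st; Ld ij]
  | C9 i j t (ij : (i < j)%N) (jt : (j < t)%N) :
      R'_rel [:: Ld ij; Ld jt] [:: Ld jt; Ld ij; Ld (ltn_trans ij jt)]
  | C10 i j (ij : (i < j)%N) :
      R'_rel [:: Ld ij; La i; Ld ij] [:: La i; Ld ij]
  | C11 i j (ij : (i < j)%N) :
      R'_rel [:: Ld ij; La j; Ld ij] [:: Ld ij; La j]
  | C12 i j (ij : (i < j)%N) :
      R'_rel [:: La i; La j; Ld ij] [:: Ld ij; La i; La j]
  | Z1 k : R'_rel [:: La k; Lc k] [:: Lc k]
  | Z2 i j (ij : (i < j)%N) : R'_rel [:: Lc i; Ld ij] [:: Lc i]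
  | Z3 i j (ij : (i < j)%N) : R'_rel [:: Ld ij; Lc j] [:: Lc j]
  | I1 k : R'_rel [:: La k; Lainv k] [::]
  | I2 k : R'_rel [:: Lainv k; La k] [::].

Definition R' : set (seq (Omega n) * seq (Omega n)) :=
  [set p | R'_rel p.1 p.2]%classic.

End Relations.

Arguments R' n : clear implicits.

(* Main.v *)
Require Import Defs.
From mathcomp Require Import all_boot all_order all_algebra.
From mathcomp Require Import boolp classical_sets cardinality.
From mathcomp Require Import zify.

(** The letters a_k, a_k^-1, c_k, d_ij stand for matrices acting on the left by
    row operations: a_k and a_k^-1 translate row k by 1 and -1, c_k erases row
    k, and d_ij adds (takes the maximum of) row j to row i.  The relations hold
    for these matrices ([gen_mat_rel]), so the presented monoid P maps to
    UT_n(Z_max) by a morphism [interp].  The theorem says that this morphism is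
    bijective, and the inverse is exhibited as a normal form.

    Write t_ij(x) for the transvection with off-diagonal entry x, which in P is
    the conjugate a_i^x d_ij a_i^-x ([transv]), and D_i(x) for the diagonal
    element that scales row i by x ([diag]); x = -oo gives t_ij = 1 and
    D_i = c_i.  A matrix M which differs from the identity in row i only is the
    product of the t_it(M_it), t > i, followed by D_i(M_ii) ([row_elem]), and
    an arbitrary upper triangular M is the product of such row elements taken
    from the last row to the first ([nf]): when row i is installed, all rows
    below it are still those of the identity matrix.  No division is needed,
    so diagonal entries -oo cause no trouble.  This gives [interp_nf], the
    surjectivity of [interp].

    For injectivity it is enough that nf (g M) = g nf(M) in P for every
    generator g ([nf_gen]); by induction on words, every element of P is then
    the normal form of its matrix.  The letters a_k^{+-1} and c_k commute with
    the row elements of index above k, and row element k absorbs them.  The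
    letter d_ij commutes with the row elements of index above i other than j;
    crossing row element j it leaves behind the product of the t_it(M_jt) for
    t >= j ([d_row_elem]), which commutes with the row elements strictly
    between i and j and is finally absorbed by row element i, since
    t_it(x) t_it(y) = t_it(max(x, y)) ([transvD]).  What is needed about
    transvections in P is therefore this rule for equal positions, the
    commutations, and one commutator relation ([d_transv]); all of them follow
    by conjugating defining relations with powers of the a_k. *)

Set Implicit Arguments.
Unset Strict Implicit.
Unset Printing Implicit Defensive.

Import Order.TTheory GRing.Theory Num.Theory.
Local Open Scope group_scope.

(** * Recognising a presented monoid *)

Section Recognition.
Variables (A : choiceType) (R : set (seq A * seq A)).

Definition cl (u : seq A) : pres_monoid R := (\pi_(pres_monoid R) u)%qT.

Lemma cl_repr x : cl (repr x) = x. Proof. exact: reprK. Qed.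

Lemma cl_nil : cl [::] = 1. Proof. by []. Qed.

Lemma cl_cons x u : cl (x :: u) = cl [:: x] * cl u.
Proof. exact: (pres_pi_cat R [:: x]). Qed.

Lemma cl_rel u v : R (u, v) -> cl u = cl v.
Proof. by move=> Ruv; apply/pres_piP; exact: (gen_congr_sub Ruv). Qed.

Variables (M : monoidType) (h : A -> M).

Definition eval (u : seq A) : M := \prod_(x <- u) h x.

Hypothesis eval_rel : forall u v, R (u, v) -> eval u = eval v.

Lemma eval_congr u v : gen_congr R u v -> eval u = eval v.
Proof.
move/(_ (fun u v => eval u = eval v)); apply=> [|[u' v'] /=].
  2: exact: eval_rel.
split=> [//|//|u1 v1 w -> //|u1 u2 v1 v2 eq_u eq_v].
by rewrite /eval !big_cat /= -!/(eval _) eq_u eq_v.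
Qed.

Definition descent (x : pres_monoid R) : M := eval (repr x).

Lemma descent_cl u : descent (cl u) = eval u.
Proof. by apply/eval_congr/pres_piP; exact: cl_repr. Qed.

Lemma descent_gen x : descent (cl [:: x]) = h x.
Proof. by rewrite descent_cl /eval big_seq1. Qed.

Lemma descent1 : descent 1 = 1.
Proof. by rewrite -cl_nil descent_cl /eval big_nil. Qed.

Lemma descentM x y : descent (x * y) = descent x * descent y.
Proof.
rewrite -[x]cl_repr -[y]cl_repr -[cl _ * _](pres_pi_cat R) !descent_cl.
by rewrite /eval big_cat.
Qed.

(** Equivariance under the generators forces W (eval u) = cl u for all words u,
    so W is a left inverse of [descent] as well as a right inverse; it is then
    multiplicative because [descent] is. *)
Lemma presented_by_normal_form (W : M -> pres_monoid R) :
  W 1 = 1 -> (forall x m, W (h x * m) = cl [:: x] * W m) ->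
  (forall m, descent (W m) = m) -> presented_by R M.
Proof.
move=> W1 Wgen descentK.
have Wdescent : cancel descent W.
  move=> x; rewrite -[x]cl_repr descent_cl; elim: (repr x) => [|y u IHu].
    by rewrite /eval big_nil.
  by rewrite /eval big_cons Wgen -/(eval u) IHu -cl_cons.
exists W; last by exists descent.
split=> // m1 m2.
by rewrite -{1}[m1]descentK -{1}[m2]descentK -descentM Wdescent.
Qed.

End Recognition.

(** * Integer powers of an invertible element *)

Section IntegerPowers.
Variables (G : monoidType) (u v : G).
Hypotheses (uv : u * v = 1) (vu : v * u = 1).

Definition zpow (m : int) : G :=
  match m with Posz p => u ^+ p | Negz p => v ^+ p.+1 end.

Lemma zpow_succ m : zpow (m + 1)%R = u * zpow m.
Proof.
case: m => [p|[|p]].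
- have -> : (Posz p + 1 = p.+1)%R by lia.
  exact: expgS.
- by rewrite /= uv.
have -> : (Negz p.+1 + 1 = Negz p)%R by lia.
by rewrite /= (expgS v p.+1) mulgA uv mul1g.
Qed.

Lemma zpow_pred m : zpow (m - 1)%R = v * zpow m.
Proof. by rewrite -{2}[m](subrK 1%R) zpow_succ mulgA vu mul1g. Qed.

Lemma zpowD m p : zpow (m + p)%R = zpow m * zpow p.
Proof.
elim/int_rec: m => [|m IHm|m IHm]; first by rewrite add0r mul1g.
  by rewrite intS (addrC 1%R) addrAC !zpow_succ IHm mulgA.
by rewrite intS opprD (addrC (- 1)%R) addrAC !zpow_pred IHm mulgA.
Qed.

Lemma zpowN m : zpow m * zpow (- m)%R = 1.
Proof. by rewrite -zpowD subrr. Qed.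

Lemma commute_inv x : commute x u -> commute x v.
Proof.
move=> xu; rewrite /commute -[RHS]mulg1 -[in RHS]uv !mulgA -(mulgA v).
by rewrite xu mulgA vu mul1g.
Qed.

Lemma commute_zpow x m : commute x u -> commute x (zpow m).
Proof.
move=> xu; case: m => p; apply: commuteX => //; exact: commute_inv.
Qed.

Definition zconj m x := zpow m * x * zpow (- m)%R.

Lemma zconjM m x y : zconj m (x * y) = zconj m x * zconj m y.
Proof.
rewrite /zconj !mulgA -(mulgA (_ * x) (zpow (- m)%R)).
by rewrite -zpowD addNr mulg1.
Qed.

Lemma zconjD m p x : zconj (m + p)%R x = zconj m (zconj p x).
Proof. by rewrite /zconj opprD (addrC (- m)%R) !zpowD !mulgA. Qed.

Lemma zconj_id m x : commute x u -> zconj m x = x.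
Proof.
move=> xu; rewrite /zconj -(commute_zpow m xu) -mulgA zpowN.
exact: mulg1.
Qed.

Lemma zconjC m x : zpow m * x = zconj m x * zpow m.
Proof. by rewrite /zconj -mulgA -zpowD addNr mulg1. Qed.

Lemma commute_zconj x y m :
  commute x u -> commute x y -> commute x (zconj m y).
Proof.
move=> xu xy; apply: commuteM; last exact: commute_zpow.
by apply: commuteM => //; exact: commute_zpow.
Qed.

End IntegerPowers.

Lemma zpowM (G : monoidType) (u v u' v' : G) m :
  commute u u' -> commute v v' ->
  zpow (u * u') (v * v') m = zpow u v m * zpow u' v' m.
Proof. by move=> uu' vv'; case: m => p; rewrite /zpow expgMn. Qed.

(** * Transvections in the presented monoid *)

Section Normal_form.
Variable n : nat.
Notation P := (pres_monoid (R' n)).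
Implicit Types i j k s t : 'I_n.

Definition a k : P := cl (R' n) [:: La k].
Definition ai k : P := cl (R' n) [:: Lainv k].
Definition c k : P := cl (R' n) [:: Lc k].

(** The value 1 outside i < j makes [d] a total function of its indices, so that
    no proof of i < j occurs in products. *)
Definition d i j : P :=
  match sumbool_of_bool (i < j)%N with
  | left ij => cl (R' n) [:: Ld ij]
  | right _ => 1
  end.

Lemma dE i j (ij : (i < j)%N) : d i j = cl (R' n) [:: Ld ij].
Proof.
rewrite /d; case: sumbool_of_bool => ij'; last by rewrite ij in ij'.
by rewrite (bool_irrelevance ij ij').
Qed.

Lemma relation u v : R'_rel u v -> cl (R' n) u = cl (R' n) v.
Proof. by move=> uv; apply: cl_rel. Qed.

Lemma a_ai k : a k * ai k = 1.
Proof. by rewrite -cl_cons (relation (I1 k)). Qed.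

Lemma ai_a k : ai k * a k = 1.
Proof. by rewrite -cl_cons (relation (I2 k)). Qed.

Lemma a_comm i j : commute (a i) (a j).
Proof.
rewrite /commute -!cl_cons.
case: (ltngtP i j) => [ij|ji|/val_inj -> //]; first exact: relation (C1 ij).
exact/esym/relation/C1.
Qed.

Lemma c_a_comm k l : commute (c k) (a l).
Proof. by rewrite /commute -!cl_cons; exact/esym/relation/C5. Qed.

Lemma c_comm i j : commute (c i) (c j).
Proof.
rewrite /commute -!cl_cons.
case: (ltngtP i j) => [ij|ji|/val_inj -> //]; first exact: relation (C2 ij).
exact/esym/relation/C2.
Qed.

Lemma cc k : c k * c k = c k.
Proof. by rewrite -cl_cons; exact/relation/C3. Qed.

Lemma ac k : a k * c k = c k.
Proof. by rewrite -cl_cons; exact/relation/Z1. Qed.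

Section Transvections.
Variables (i j : 'I_n) (ij : (i < j)%N).

Lemma dd : d i j * d i j = d i j.
Proof. by rewrite dE -cl_cons; exact/relation/C4. Qed.

Lemma d_a_comm k : k != i -> k != j -> commute (d i j) (a k).
Proof.
move=> /eqP ki /eqP kj; rewrite /commute dE -!cl_cons.
exact/esym/relation/C6.
Qed.

Lemma d_c_comm k : k != i -> k != j -> commute (d i j) (c k).
Proof.
move=> /eqP ki /eqP kj; rewrite /commute dE -!cl_cons.
exact/esym/relation/C7.
Qed.

Lemma d_comm s t : (s < t)%N -> j != s -> t != i -> commute (d i j) (d s t).
Proof.
move=> st /eqP js /eqP ti; rewrite /commute (dE ij) (dE st) -!cl_cons.
exact/relation/C8.
Qed.

Lemma d_shift t : (j < t)%N -> d i j * d j t = d j t * (d i j * d i t).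
Proof.
move=> jt; rewrite (dE ij) (dE jt) (dE (ltn_trans ij jt)).
by rewrite -cl_cons (relation (C9 ij jt)) !(cl_cons _ _ (_ :: _)).
Qed.

Lemma d_ai_d : d i j * (a i * d i j) = a i * d i j.
Proof.
by have := relation (C10 ij); rewrite !(cl_cons _ _ (_ :: _)) -(dE ij).
Qed.

Lemma d_aj_d : d i j * (a j * d i j) = d i j * a j.
Proof.
by have := relation (C11 ij); rewrite !(cl_cons _ _ (_ :: _)) -(dE ij).
Qed.

Lemma d_aa_comm : commute (d i j) (a i * a j).
Proof.
have := relation (C12 ij); rewrite !(cl_cons _ _ (_ :: _)) -(dE ij) => aad.
by rewrite /commute -mulgA -aad.
Qed.

Lemma c_d : c i * d i j = c i.
Proof. by rewrite (dE ij) -!cl_cons; exact/relation/Z2. Qed.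

Lemma d_c : d i j * c j = c j.
Proof. by rewrite (dE ij) -!cl_cons; exact/relation/Z3. Qed.

End Transvections.

Notation apow k := (zpow (a k) (ai k)).
Notation aconj k := (zconj (a k) (ai k)).

Lemma apow_succ k m : apow k (m + 1)%R = a k * apow k m.
Proof. exact/zpow_succ/a_ai. Qed.

Lemma apow_pred k m : apow k (m - 1)%R = ai k * apow k m.
Proof. by apply: zpow_pred; [exact: a_ai|exact: ai_a]. Qed.

Lemma apowD k m p : apow k (m + p)%R = apow k m * apow k p.
Proof. by apply: zpowD; [exact: a_ai|exact: ai_a]. Qed.

Lemma apowN k m : apow k m * apow k (- m)%R = 1.
Proof. by apply: zpowN; [exact: a_ai|exact: ai_a]. Qed.

Lemma apow_comm k m x : commute x (a k) -> commute x (apow k m).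
Proof. by apply: commute_zpow; [exact: a_ai|exact: ai_a]. Qed.

Lemma aconjM k m x y : aconj k m (x * y) = aconj k m x * aconj k m y.
Proof. by apply: zconjM; [exact: a_ai|exact: ai_a]. Qed.

Lemma aconjD k m p x : aconj k (m + p)%R x = aconj k m (aconj k p x).
Proof. by apply: zconjD; [exact: a_ai|exact: ai_a]. Qed.

Lemma aconj_id k m x : commute x (a k) -> aconj k m x = x.
Proof. by apply: zconj_id; [exact: a_ai|exact: ai_a]. Qed.

Lemma aconjC k m x : apow k m * x = aconj k m x * apow k m.
Proof. by apply: zconjC; [exact: a_ai|exact: ai_a]. Qed.

Lemma aconj_comm k m x y :
  commute x (a k) -> commute x y -> commute x (aconj k m y).
Proof. by apply: commute_zconj; [exact: a_ai|exact: ai_a]. Qed.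

Definition transv i j (x : Zmax) : P :=
  if x is Some m then aconj i m (d i j) else 1.

Definition diag k (x : Zmax) : P := if x is Some m then apow k m else c k.

(** Since a_i a_j commutes with d_ij, so do its powers. Having both descriptions
    of a transvection allows conjugating by whichever of a_i, a_j commutes with
    the other factor at hand. *)
Lemma aconj_d i j m : (i < j)%N -> aconj i m (d i j) = aconj j (- m)%R (d i j).
Proof.
move=> ij; have := @commute_inv P (a j) (ai j) (@a_ai j) (@ai_a j).
move=> /(_ _ (a_comm i j)) /commute_sym aij.
have := @commute_inv P (a i) (ai i) (@a_ai i) (@ai_a i) _ aij.
move=> /commute_sym ai_comm.
have aaK : (a i * a j) * (ai i * ai j) = 1.
  by rewrite ai_comm -mulgA (mulgA (a j)) a_ai mul1g a_ai.
have aaKV : (ai i * ai j) * (a i * a j) = 1.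
  by rewrite ai_comm -mulgA (mulgA (ai i)) ai_a mul1g ai_a.
have := commute_zpow aaK aaKV m (d_aa_comm ij).
rewrite (zpowM _ (a_comm i j) ai_comm) /commute mulgA => dapow.
have apowC : commute (apow i m) (apow j m).
  apply: apow_comm; apply: commute_sym.
  by apply: apow_comm; exact: a_comm.
rewrite /zconj opprK -[LHS]mul1g -(apowN j (- m)) opprK.
rewrite -!mulgA (mulgA (apow j m)) (mulgA (_ * _) (d i j)) -apowC -dapow.
by rewrite -(mulgA (d i j)) apowC -!mulgA apowN mulg1.
Qed.

Lemma transv_a_comm i j k x : (i < j)%N -> k != i -> k != j ->
  commute (a k) (transv i j x).
Proof.
move=> ij ki kj; case: x => [m|]; last exact: commute1.
apply: aconj_comm (a_comm _ _) _.
by apply: commute_sym; apply: d_a_comm.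
Qed.

Lemma transv_c_comm i j k x : (i < j)%N -> k != i -> k != j ->
  commute (c k) (transv i j x).
Proof.
move=> ij ki kj; case: x => [m|]; last exact: commute1.
apply: aconj_comm (c_a_comm _ _) _.
by apply: commute_sym; apply: d_c_comm.
Qed.

(** For k = 1 these are conjugates of d a_i d = a_i d and d a_j d = d a_j; the
    general case chains such steps through the transvections with entries m + 1,
    m + 2, and so on. *)
Lemma transv_absorb i j m (k : nat) : (i < j)%N ->
  let tm := transv i j (Some m) in let tmk := transv i j (Some (m + k)%R) in
  tm * tmk = tmk /\ tmk * tm = tmk.
Proof.
move=> ij; cbv zeta; elim: k => [|k [IHl IHr]].
  by rewrite addr0 /transv -aconjM dd.
have step p : transv i j (Some p) * transv i j (Some (p + 1)%R) =
    transv i j (Some (p + 1)%R).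
  rewrite /transv aconjD -aconjM.
  congr (zconj _ _ _ _).
  have -> : aconj i 1 (d i j) = a i * d i j * ai i by [].
  by rewrite mulgA d_ai_d.
have step' p : transv i j (Some (p + 1)%R) * transv i j (Some p) =
    transv i j (Some (p + 1)%R).
  rewrite /transv !aconj_d //; have -> : (- p = - (p + 1) + 1)%R by lia.
  rewrite aconjD -aconjM.
  congr (zconj _ _ _ _).
  have -> : aconj j 1 (d i j) = a j * d i j * ai j by [].
  by rewrite mulgA d_aj_d // -mulgA a_ai mulg1.
have -> : (m + k.+1 = m + k + 1)%R by lia.
by split; [rewrite -step mulgA IHl|rewrite -step' -mulgA IHr].
Qed.

Lemma transvD i j x y : (i < j)%N ->
  transv i j x * transv i j y = transv i j (x + y)%R.
Proof.
move=> ij; case: x y => [m|] [p|]; rewrite ?mul1g ?mulg1 //.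
have -> : ((Some m : Zmax) + (Some p : Zmax) = Some (Num.max m p))%R by [].
have [le_mp|/ltW le_pm] := lerP m p.
  have [absorb _] := transv_absorb m `|p - m|%N ij; move: absorb.
  by rewrite gez0_abs ?subr_ge0 // (addrC m) subrK.
have [_ absorb] := transv_absorb p `|m - p|%N ij; move: absorb.
by rewrite gez0_abs ?subr_ge0 // (addrC p) subrK.
Qed.

(** In the same row, write the transvections as conjugates by a_j and a_t, each
    of which commutes with the other transvection. *)
Lemma transv_comm_row i j t x y : (i < j)%N -> (i < t)%N ->
  commute (transv i j x) (transv i t y).
Proof.
move=> ij it; have [<-|jt] := eqVneq j t.
  by rewrite /commute !transvD // addrC.
case: x y => [m|] [p|]; try exact: commute1; last first.
  by apply: commute_sym; exact: commute1.
rewrite /transv !aconj_d //.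
have ti : t != i by rewrite neq_ltn it orbT.
have ji : j != i by rewrite neq_ltn ij orbT.
apply: commute_sym; apply: aconj_comm.
  apply: commute_sym; apply: aconj_comm (a_comm _ _) _.
  by apply: commute_sym; apply: d_a_comm.
apply: commute_sym; apply: aconj_comm.
  by apply: d_a_comm => //; rewrite eq_sym.
by apply: d_comm.
Qed.

(** In different rows, the conjugating elements a_i and a_s already commute with
    the other factor. *)
Lemma transv_comm i j s t x y :
  (i < j)%N -> (s < t)%N -> i != s -> j != s -> i != t ->
  commute (transv i j x) (transv s t y).
Proof.
move=> ij st si js ti.
case: x y => [m|] [p|]; try exact: commute1; last first.
  by apply: commute_sym; exact: commute1.
apply: commute_sym; apply: aconj_comm.
  apply: commute_sym; exact: (@transv_a_comm s t i (Some p)).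
apply: commute_sym; apply: aconj_comm.
  by apply: d_a_comm => //; rewrite eq_sym.
by apply: d_comm => //; rewrite eq_sym.
Qed.

Lemma apow_transv i j m x : (i < j)%N ->
  apow i m * transv i j x = transv i j ((Some m : Zmax) * x)%R * apow i m.
Proof.
move=> ij; case: x => [p|]; last by rewrite mul1g mulg1.
by rewrite /transv aconjC -aconjD.
Qed.

Lemma apow_diag i m x : apow i m * diag i x = diag i ((Some m : Zmax) * x)%R.
Proof.
case: x => [p|] /=; first by rewrite -apowD.
elim/int_rec: m => [|m IHm|m IHm]; first exact: mul1g.
  by rewrite intS addrC apow_succ -mulgA IHm ac.
rewrite intS opprD addrC apow_pred -mulgA IHm.
by rewrite -{1}ac mulgA ai_a mul1g.
Qed.

Lemma c_diag k x : c k * diag k x = c k.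
Proof.
case: x => [m|]; last exact: cc.
by rewrite (apow_comm _ (c_a_comm k k)); exact: (apow_diag k m None).
Qed.

Lemma c_transv i j x : (i < j)%N -> c i * transv i j x = c i.
Proof.
move=> ij; case: x => [m|]; last exact: mulg1.
have c_apow p : c i * apow i p = c i by exact: (c_diag i (Some p)).
by rewrite /transv /zconj !mulgA c_apow c_d // c_apow.
Qed.

(** Conjugate the defining relation by a power of a_t, with which d_ij
    commutes. *)
Lemma d_transv i j t x : (i < j)%N -> (j < t)%N ->
  d i j * transv j t x = transv j t x * (d i j * transv i t x).
Proof.
move=> ij jt; case: x => [m|]; last by rewrite !mul1g.
have it := ltn_trans ij jt.
rewrite /transv !(@aconj_d _ t) //.
have dt : commute (d i j) (a t).
  by apply: d_a_comm; rewrite // neq_ltn ?it ?jt orbT.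
rewrite -[X in X * _ = _](aconj_id (- m)%R dt).
rewrite -[X in _ = _ * (X * _)](aconj_id (- m)%R dt).
by rewrite -!aconjM d_shift.
Qed.

Lemma d_diag i j x : (i < j)%N -> d i j * diag j x = diag j x * transv i j x.
Proof.
move=> ij; case: x => [m|] /=; last by rewrite d_c // mulg1.
rewrite aconj_d // aconjC -aconjD subrr.
by rewrite /zconj mul1g /= mulg1.
Qed.

Lemma transv_diag_comm i j k x y : (i < j)%N -> k != i -> k != j ->
  commute (transv i j x) (diag k y).
Proof.
move=> ij ki kj; case: y => [m|]; last exact/commute_sym/transv_c_comm.
by apply: apow_comm; exact/commute_sym/transv_a_comm.
Qed.

Lemma diag_comm i k x y : commute (diag i x) (diag k y).
Proof.
have a_diag l z r : commute (a l) (diag r z).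
  case: z => [m|]; last exact/commute_sym/c_a_comm.
  by apply: apow_comm; exact: a_comm.
case: x => [m|].
  apply: commute_sym; apply: apow_comm.
  exact/commute_sym/a_diag.
case: y => [p|]; last exact: c_comm.
apply: apow_comm; exact: c_a_comm.
Qed.

(** * Rows and the normal form *)

Definition row_transv i (v : 'I_n -> Zmax) : P :=
  \prod_(t : 'I_n | (i < t)%N) transv i t (v t).

(** The element of P for the matrix equal to the identity outside row i, whose
    row i is v from the diagonal on. *)
Definition row_elem i (v : 'I_n -> Zmax) : P := row_transv i v * diag i (v i).

Lemma eq_row_elem i v w :
  (forall t, (i <= t)%N -> v t = w t) -> row_elem i v = row_elem i w.
Proof.
move=> vw; rewrite /row_elem (vw i) //; congr (_ * _).
by apply: eq_bigr => t /ltnW /vw ->.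
Qed.

Lemma row_transvD i v w :
  row_transv i v * row_transv i w = row_transv i (fun t => v t + w t)%R.
Proof.
rewrite /row_transv -prodgM_commute => [|t r it ir].
  2: exact: transv_comm_row.
by apply: eq_bigr => t it; exact: transvD.
Qed.

Lemma apow_row_elem k m v :
  apow k m * row_elem k v = row_elem k (fun t => (Some m : Zmax) * v t)%R.
Proof.
rewrite /row_elem -apow_diag !mulgA; congr (_ * _); rewrite /row_transv.
elim: (index_enum _) => [|t r IHr]; first by rewrite !big_nil mulg1 mul1g.
rewrite !big_cons; case: ifP => // kt.
by rewrite mulgA apow_transv // -mulgA IHr mulgA.
Qed.

Lemma c_row_elem k v : c k * row_elem k v = row_elem k (fun=> 0%R).
Proof.
have -> : row_elem k (fun=> 0%R) = c k.
  by rewrite /row_elem /row_transv big1 ?mul1g.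
rewrite /row_elem mulgA; set y := _ * row_transv k v.
suff -> : y = c k by exact: c_diag.
rewrite {}/y /row_transv; elim: (index_enum _) => [|t r IHr].
  by rewrite big_nil mulg1.
by rewrite big_cons; case: ifP => // kt; rewrite mulgA c_transv.
Qed.

Lemma row_transv_row_elem i u v : u i = 0%R ->
  row_transv i u * row_elem i v = row_elem i (fun t => u t + v t)%R.
Proof. by move=> ui0; rewrite /row_elem mulgA row_transvD ui0 add0r. Qed.

Definition from j (v : 'I_n -> Zmax) t : Zmax :=
  if (j <= t)%N then v t else 0%R.

Lemma row_transv_from i j v : (i < j)%N ->
  row_transv i (from j v) =
  transv i j (v j) * \prod_(t : 'I_n | (j < t)%N) transv i t (v t).
Proof.
move=> ij.
pose u1 t : Zmax := if t == j then v t else 0%R.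
pose u2 t : Zmax := if (j < t)%N then v t else 0%R.
have -> : transv i j (v j) = row_transv i u1.
  have <- : \prod_(t : 'I_n | t == j) transv i t (v t) = transv i j (v j).
    exact: big_pred1_eq.
  rewrite /row_transv big_mkcond [RHS]big_mkcond.
  apply: eq_bigr => t _; rewrite /u1 /=.
  by case: eqVneq => [->|_]; rewrite ?ij //; case: ifP.
have -> : \prod_(t : 'I_n | (j < t)%N) transv i t (v t) = row_transv i u2.
  rewrite /row_transv !(big_mkcond (fun t : 'I_n => _ < t)%N) /u2.
  apply: eq_bigr => t _; case: (ltnP j t) => jt; last by case: ifP.
  by rewrite (ltn_trans ij jt).
rewrite row_transvD; apply: eq_bigr => t it.
rewrite /from /u1 /u2; congr (transv i t _).
rewrite -val_eqE /=; case: (ltngtP j t) => [_|_|_].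
- by rewrite add0r.
- by rewrite addr0.
- by rewrite addr0.
Qed.

(** Crossing transv j t (v t) creates transv i t (v t), and crossing the
    diagonal factor turns d_ij itself into transv i j (v j). *)
Lemma d_row_elem i j v : (i < j)%N ->
  d i j * row_elem j v = row_elem j v * row_transv i (from j v).
Proof.
move=> ij; pose F := \prod_(t : 'I_n | (j < t)%N) transv i t (v t).
have d_row : d i j * row_transv j v = row_transv j v * (d i j * F).
  rewrite /F /row_transv; elim: (index_enum _) => [|t r IHr].
    by rewrite !big_nil mul1g mulg1.
  rewrite !big_cons; case: ifP => // jt.
  set Pj := \prod_(_ <- _ | _) _; set Pi := \prod_(_ <- _ | _) _.
  rewrite -/Pj -/Pi in IHr.
  have it := ltn_trans ij jt.
  have t_Pi : commute (transv i t (v t)) Pi.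
    apply: commute_prod => s js.
    by apply: transv_comm_row; rewrite ?(ltn_trans ij js).
  have t_Pj : commute (transv i t (v t)) Pj.
    apply: commute_prod => s js.
    apply: transv_comm => //; rewrite neq_ltn ?ij //.
      by rewrite jt orbT.
    by rewrite (ltn_trans ij js).
  rewrite mulgA d_transv // -!mulgA; congr (_ * _).
  by rewrite t_Pj mulgA IHr -!mulgA t_Pi.
have F_diag : commute F (diag j (v j)).
  apply: commute_sym; apply: commute_prod => t jt.
  apply: commute_sym; apply: transv_diag_comm; rewrite ?(ltn_trans ij jt) //.
    by rewrite neq_ltn ij orbT.
  by rewrite neq_ltn jt.
rewrite row_transv_from // {1}/row_elem mulgA d_row -!mulgA F_diag.
by rewrite (mulgA (d i j)) d_diag // !mulgA.
Qed.

Definition upd (M : 'I_n -> 'I_n -> Zmax) k v i := if i == k then v else M i.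

Lemma upd_eq M k v : upd M k v k = v.
Proof. by rewrite /upd eqxx. Qed.

Lemma upd_neq M k v i : i != k -> upd M k v i = M i.
Proof. by rewrite /upd => /negPf ->. Qed.

Definition rows (s : seq 'I_n) (M : 'I_n -> 'I_n -> Zmax) : P :=
  \prod_(i <- s) row_elem i (M i).

Definition gtord (i j : 'I_n) := (j < i)%N.

Lemma gtord_trans : transitive gtord.
Proof. by move=> j i k ji kj; apply: ltn_trans kj ji. Qed.

(** An element that crosses all row elements above index k only needs to be
    absorbed by row element k.  The indices form an arbitrary descending list
    because, for d_ij, this is applied to the part of the list after j. *)
Lemma rows_upd g k v (s : seq 'I_n) M : sorted gtord s -> k \in s ->
  (forall i, i \in s -> (k < i)%N -> commute g (row_elem i (M i))) ->
  g * row_elem k (M k) = row_elem k v -> g * rows s M = rows s (upd M k v).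
Proof.
move=> + + + gk; elim: s => //= x s IHs s_sorted.
rewrite inE /rows !big_cons mulgA.
have s_lt := order_path_min gtord_trans s_sorted.
have [eq_kx _ _|/= kx ks gC] := eqVneq k x.
  subst x; rewrite gk upd_eq; congr (_ * _).
  apply: eq_big_seq => i /(allP s_lt) ix.
  by rewrite upd_neq // neq_ltn (ix : (i < k)%N).
rewrite upd_neq 1?eq_sym // gC ?mem_head //; last exact: (allP s_lt).
rewrite -mulgA; congr (_ * _).
apply: IHs => // [|i si ki]; first exact: path_sorted s_sorted.
by apply: gC => //; rewrite inE si orbT.
Qed.

Lemma commute_row_elem g i v :
  (forall t, (i < t)%N -> commute g (transv i t (v t))) ->
  commute g (diag i (v i)) -> commute g (row_elem i v).
Proof.
by move=> g_transv g_diag; apply: commuteM => //; exact: commute_prod.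
Qed.

Lemma apow_row_comm k m i v : (k < i)%N -> commute (apow k m) (row_elem i v).
Proof.
move=> ki; apply: commute_row_elem => [t it|].
  2: exact: (diag_comm k i (Some m)).
apply/commute_sym/(@transv_diag_comm i t k _ (Some m)) => //.
  by rewrite neq_ltn ki.
rewrite neq_ltn.
by rewrite (ltn_trans ki it).
Qed.

Lemma c_row_comm k i v : (k < i)%N -> commute (c k) (row_elem i v).
Proof.
move=> ki; apply: commute_row_elem => [t it|]; last exact: (diag_comm k i None).
apply: transv_c_comm => //; rewrite neq_ltn ?ki //.
by rewrite (ltn_trans ki it).
Qed.

Lemma transv_row_comm i j x (r : 'I_n) v : (i < j)%N -> (i < r)%N -> r != j ->
  commute (transv i j x) (row_elem r v).
Proof.
move=> ij ir rj; apply: commute_row_elem => [t rt|].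
  apply: transv_comm; rewrite // ?neq_ltn ?ir ?(ltn_trans ir rt) //.
  by rewrite -neq_ltn eq_sym.
by apply: transv_diag_comm; rewrite // neq_ltn ir orbT.
Qed.

Lemma d_transv0 i j : d i j = transv i j (Some 0%R).
Proof. by rewrite /transv /zconj oppr0 /= mul1g mulg1. Qed.

Lemma rows_d i j (s : seq 'I_n) M :
  (i < j)%N -> sorted gtord s -> i \in s -> j \in s ->
  d i j * rows s M = rows s (upd M i (fun t => from j (M j) t + M i t)%R).
Proof.
move=> ij; elim: s => // x s IHs s_sorted.
have s_lt := order_path_min gtord_trans s_sorted.
have sorted_s := path_sorted s_sorted.
rewrite !inE {1}/rows big_cons mulgA -/(rows s M).
move=> /predU1P i_xs /predU1P[jx|js].
  case: i_xs => [ix|si]; first by rewrite jx ix ltnn in ij.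
  rewrite -jx d_row_elem // -mulgA.
  rewrite (@rows_upd _ i (fun t => from j (M j) t + M i t)%R) //.
  - by rewrite [RHS]big_cons upd_neq // neq_ltn ij orbT.
  - move=> r /(allP s_lt) rx ir.
    apply: commute_sym; apply: commute_prod => t it.
    rewrite /from; case: ifP => [jt|_]; last exact: commute1.
    apply: commute_sym; apply: transv_row_comm => //.
    by rewrite neq_ltn (leq_trans _ jt) // jx.
  - by apply: row_transv_row_elem; rewrite /from leqNgt ij.
have jx : (j < x)%N := allP s_lt j js.
have ix := ltn_trans ij jx.
case: i_xs => [eq_ix|si]; first by rewrite eq_ix ltnn in ix.
have -> : d i j * row_elem x (M x) = row_elem x (M x) * d i j.
  by rewrite d_transv0; apply: transv_row_comm => //; rewrite neq_ltn jx orbT.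
by rewrite -mulgA IHs // [RHS]big_cons upd_neq // neq_ltn ix orbT.
Qed.

Definition nf (M : 'I_n -> 'I_n -> Zmax) : P := rows (rev (enum 'I_n)) M.

Lemma gtord_enum : sorted gtord (rev (enum 'I_n)).
Proof.
have := iota_ltn_sorted 0 n.
by rewrite -val_enum_ord sorted_map rev_sorted.
Qed.

Lemma mem_rev_enum i : i \in rev (enum 'I_n).
Proof. by rewrite mem_rev mem_enum. Qed.

Lemma eq_nf M N : (forall i j, (i <= j)%N -> M i j = N i j) -> nf M = nf N.
Proof.
by move=> MN; apply: eq_bigr => i _; apply: eq_row_elem => t; exact: MN.
Qed.

Lemma nf_apow k m M :
  apow k m * nf M = nf (upd M k (fun t => (Some m : Zmax) * M k t)%R).
Proof.
apply: rows_upd (apow_row_elem _ _ _).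
  1,2: by rewrite ?gtord_enum ?mem_rev_enum.
move=> i _.
exact: apow_row_comm.
Qed.

Lemma nf_c k M : c k * nf M = nf (upd M k (fun=> 0%R)).
Proof.
apply: rows_upd (c_row_elem _ _); rewrite ?gtord_enum ?mem_rev_enum // => i _.
exact: c_row_comm.
Qed.

Lemma nf_d i j M : (i < j)%N ->
  d i j * nf M = nf (upd M i (fun t => from j (M j) t + M i t)%R).
Proof. by move=> ij; rewrite /nf rows_d ?gtord_enum ?mem_rev_enum. Qed.

Lemma nf_one : nf (fun i j => (i == j)%:R%R) = 1.
Proof.
rewrite /nf /rows big1 // => i _; rewrite /row_elem /row_transv big1 => [|t it].
  by rewrite eqxx mul1g.
by rewrite -val_eqE ltn_eqF.
Qed.

End Normal_form.
(** * The generating matrices *)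

Section Matrices.
Variable n : nat.
Implicit Types (i j k s t : 'I_n) (N : UT Zmax n) (x : Zmax).

Definition dmat_mx k x : 'M[Zmax]_n :=
  (\matrix_(i, j) ((i == j)%:R * (if i == k then x else 1)))%R.

Definition tmat_mx i j : 'M[Zmax]_n :=
  (\matrix_(s, t) ((s == t)%:R + ((s == i) && (t == j))%:R))%R.

Lemma dmat_upper k x : upper_trig (dmat_mx k x).
Proof.
by apply/upper_trigP => i j ji; rewrite mxE -val_eqE gtn_eqF // mul0r.
Qed.

Lemma tmat_upper i j (ij : (i < j)%N) : upper_trig (tmat_mx i j).
Proof.
apply/upper_trigP => s t ts; rewrite mxE -val_eqE gtn_eqF // add0r.
by case: eqP => //= si; case: eqP => // tj; subst s t; lia.
Qed.

Definition dmat k x : UT Zmax n := MkUT (dmat_upper k x).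
Definition tmat i j (ij : (i < j)%N) : UT Zmax n := MkUT (tmat_upper ij).

Lemma UT_mulE N1 N2 s t :
  UTval (N1 * N2) s t = (\sum_r UTval N1 s r * UTval N2 r t)%R.
Proof. by rewrite [LHS]mxE. Qed.

Lemma dmatE k x N s t :
  UTval (dmat k x * N) s t =
  if s == k then (x * UTval N s t)%R else UTval N s t.
Proof.
rewrite UT_mulE (bigD1 s) //= mxE eqxx mul1r big1 => [|r rs].
  by rewrite addr0; case: eqP; rewrite ?mul1r.
by rewrite mxE eq_sym (negPf rs) !mul0r.
Qed.

Lemma tmatE i j (ij : (i < j)%N) N s t :
  UTval (tmat ij * N) s t =
  (UTval N s t + (if s == i then UTval N j t else 0))%R.
Proof.
rewrite UT_mulE; under eq_bigr do rewrite mxE mulrDl.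
rewrite big_split /=; congr (_ + _)%R.
  rewrite (bigD1 s) //= eqxx mul1r big1 ?addr0 // => r rs.
  by rewrite eq_sym (negPf rs) mul0r.
case: eqP => _ /=; last by rewrite big1 // => r _; rewrite mul0r.
rewrite (bigD1 j) //= eqxx mul1r big1 ?addr0 // => r rj.
by rewrite (negPf rj) mul0r.
Qed.

Lemma UT_eqP N1 N2 : (forall s t, UTval N1 s t = UTval N2 s t) -> N1 = N2.
Proof. by move=> eqN; apply/val_inj/matrixP. Qed.

Definition gen_mat (x : Omega n) : UT Zmax n :=
  match x with
  | La k => dmat k (Some 1%R)
  | Lainv k => dmat k (Some (-1)%R)
  | Lc k => dmat k None
  | @Ld _ i j ij => tmat ij
  end.

Lemma gen_mat_rel u v : R'_rel u v -> eval gen_mat u = eval gen_mat v.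
Proof.
move=> uv; apply: UT_eqP => s t.
case: uv => *; rewrite /eval !big_cons !big_nil.
all: move: (1 : UT Zmax n) => N; rewrite !(dmatE, tmatE).
(* Compare row indices; inconsistent comparisons contradict i < j < t. *)
all: repeat (case: eqP => ?; try subst); try by [].
all: try by exfalso; lia.
(* What is left are identities between max-plus expressions in entries of N. *)
all: repeat match goal with |- context [fun_of_matrix (UTval ?M) ?i ?j] =>
  case: (fun_of_matrix (UTval M) i j) => [?|] end; try by [].
all: by rewrite /GRing.mul /GRing.add /=; congr Some; lia.
Qed.

(** * The morphism to matrices inverts the normal form *)

Definition interp : pres_monoid (R' n) -> UT Zmax n := descent gen_mat.

Lemma interp1 : interp 1 = 1. Proof. exact: descent1 gen_mat_rel. Qed.

Lemma interpM (x y : pres_monoid (R' n)) : interp (x * y) = interp x * interp y.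
Proof. exact: descentM gen_mat_rel x y. Qed.

Lemma interp_gen (x : Omega n) : interp (cl (R' n) [:: x]) = gen_mat x.
Proof. exact: descent_gen gen_mat_rel x. Qed.

Lemma dmat0 k : dmat k (Some 0%R) = 1.
Proof.
apply: UT_eqP => s t; rewrite -[dmat _ _]mulg1 dmatE.
by case: eqP; rewrite ?mul1r.
Qed.

Lemma dmatM k x y : dmat k x * dmat k y = dmat k (x * y)%R.
Proof.
apply: UT_eqP => s t; rewrite -[dmat k y]mulg1 -[dmat k (x * y)%R]mulg1 !dmatE.
by case: eqP; rewrite ?mulrA.
Qed.

Lemma interp_diag k x : interp (diag k x) = dmat k x.
Proof.
case: x => [m|]; last exact: interp_gen.
elim/int_rec: m => [|m IHm|m IHm]; first by rewrite dmat0 -interp1.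
  rewrite /diag intS addrC apow_succ interpM interp_gen.
  rewrite [interp (zpow _ _ _)]IHm.
  by rewrite dmatM; congr (dmat k (Some _)); rewrite addrC.
rewrite /diag intS opprD addrC apow_pred interpM interp_gen.
rewrite [interp (zpow _ _ _)]IHm.
by rewrite dmatM; congr (dmat k (Some _)); rewrite addrC.
Qed.

Lemma interp_transvE i j x N s t : (i < j)%N ->
  UTval (interp (transv i j x) * N) s t =
  (UTval N s t + (if s == i then x * UTval N j t else 0))%R.
Proof.
move=> ij; case: x => [m|]; last first.
  by rewrite interp1 mul1g; case: ifP; rewrite addr0 // mul0r.
have -> : transv i j (Some m) =
    diag i (Some m) * d i j * diag i (Some (- m)%R) by [].
have ji : (j == i) = false by rewrite -val_eqE gtn_eqF.
rewrite !interpM !interp_diag (dE ij) interp_gen -!mulgA dmatE tmatE !dmatE ji.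
have [->|_] := eqVneq s i; last by rewrite addr0.
rewrite mulrDr mulrA; congr (_ + _)%R.
have -> : ((Some m : Zmax) * (Some (- m)%R : Zmax) = 1)%R.
  by rewrite /GRing.mul /= subrr.
by rewrite mul1r.
Qed.

Lemma interp_row_transvE i v N s t :
  UTval (interp (row_transv i v) * N) s t =
  (UTval N s t +
   (if s == i then \sum_(r : 'I_n | (i < r)%N) v r * UTval N r t else 0))%R.
Proof.
rewrite /row_transv; have [->|si] := eqVneq s i; last first.
  rewrite addr0; elim: (index_enum _) => [|j r IHr].
    by rewrite big_nil interp1 mul1g.
  rewrite big_cons; case: ifP => // ij.
  by rewrite interpM -mulgA interp_transvE // (negPf si) addr0.
have row_below r (j : 'I_n) : (i < j)%N ->
    let u := \prod_(l <- r | (i < (l : 'I_n))%N) transv i l (v l) in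
    UTval (interp u * N) j t = UTval N j t.
  move=> ij; cbv zeta; elim: r => [|l r IHr].
    by rewrite big_nil interp1 mul1g.
  rewrite big_cons; case: ifP => // il.
  by rewrite interpM -mulgA interp_transvE // -val_eqE /= gtn_eqF // addr0.
elim: (index_enum _) => [|j r IHr].
  by rewrite !big_nil interp1 mul1g addr0.
rewrite !big_cons; case: ifP => // ij.
rewrite interpM -mulgA interp_transvE // eqxx IHr row_below // -addrA.
by rewrite [(_ * _ + _)%R]addrC.
Qed.

Lemma interp_rowE i v N s t :
  UTval (interp (row_elem i v) * N) s t =
  if s == i then (\sum_(r : 'I_n | (i <= r)%N) v r * UTval N r t)%R
  else UTval N s t.
Proof.
rewrite /row_elem interpM interp_diag -mulgA interp_row_transvE dmatE.
have [->|si] := eqVneq s i; last by rewrite addr0.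
rewrite [RHS](bigD1 i) //=; congr (_ + _)%R.
apply: eq_big => [r|r ir]; first by rewrite ltn_neqAle andbC eq_sym.
by rewrite dmatE -val_eqE /= gtn_eqF.
Qed.

(** When row element k is applied, the rows from k on are still those of the
    identity, so row k becomes row k of N. *)
Lemma interp_rows (N : UT Zmax n) l : sorted (@gtord n) l ->
  forall s t, UTval (interp (rows l (UTval N))) s t =
    if s \in l then UTval N s t else (s == t)%:R%R.
Proof.
elim: l => [_ s t|k l IHl l_sorted s t].
  by rewrite /rows big_nil interp1 /= mxE.
have l_lt := order_path_min (@gtord_trans n) l_sorted.
have sorted_l := path_sorted l_sorted.
rewrite /rows big_cons interpM interp_rowE -/(rows _ _) inE.
have [->|sk] := eqVneq s k; last exact: IHl.
have row (r : 'I_n) : (k <= r)%N ->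
    UTval (interp (rows l (UTval N))) r t = (r == t)%:R%R.
  move=> kr; rewrite IHl // ifN //; apply: contraL kr => /(allP l_lt).
  by rewrite -ltnNge.
under eq_bigr => r kr do rewrite row //.
rewrite big_mkcond (bigD1 t) //= eqxx mulr1 big1 => [|r rt].
  rewrite addr0; case: leqP => // tk.
  by rewrite (upper_trigP _ (UT_upper N)).
by rewrite (negPf rt) mulr0 if_same.
Qed.

Lemma interp_nf (N : UT Zmax n) : interp (nf (UTval N)) = N.
Proof.
apply: UT_eqP => s t; rewrite interp_rows ?mem_rev_enum //; exact: gtord_enum.
Qed.

Lemma nf_gen (x : Omega n) (N : UT Zmax n) :
  nf (UTval (gen_mat x * N)) = cl (R' n) [:: x] * nf (UTval N).
Proof.
case: x => [k|k|k|i j ij] /=.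
- rewrite -[cl _ _]/(diag k (Some 1%R)) nf_apow; apply: eq_nf => s t _.
  by rewrite dmatE /upd; case: eqP => // ->.
- rewrite -[cl _ _]/(diag k (Some (-1)%R)) nf_apow; apply: eq_nf => s t _.
  by rewrite dmatE /upd; case: eqP => // ->.
- rewrite nf_c; apply: eq_nf => s t _.
  by rewrite dmatE /upd; case: eqP.
rewrite -(dE ij) (nf_d _ ij); apply: eq_nf => s t _; rewrite (tmatE ij) /upd.
case: eqP => [->|_]; last by rewrite addr0.
rewrite addrC /from; case: leqP => // tj.
by rewrite (upper_trigP _ (UT_upper N)).
Qed.

End Matrices.

(** * The presentation *)

Lemma finite_bounded_words (A : finType) m (R : set (seq A * seq A)) :
  (forall u v, R (u, v) -> size u <= m /\ size v <= m)%N -> finite_set R.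
Proof.
move=> R_le; pose f (p : m.-bseq A * m.-bseq A) := (p.1 : seq A, p.2 : seq A).
apply: (@sub_finite_set _ _ (f @` [set: _])%classic); last exact: finite_image.
by move=> [u v] /R_le [u_le v_le]; exists (Bseq u_le, Bseq v_le).
Qed.

Theorem theorem5p3 (n : nat) (n_gt0 : (0 < n)%N) :
  finitely_presented_by (R' n) (UT Zmax n).
Proof.
split; first 1 last.
- exact: finite_finset.
- have size3 u v : R'_rel u v -> (size u <= 3 /\ size v <= 3)%N by case.
  by apply: (@finite_bounded_words _ 3 (R' n)); exact: size3.
apply: (@presented_by_normal_form _ _ _ _ (@gen_mat_rel n)
  (fun N => nf (UTval N))).
- by rewrite -[RHS]nf_one; apply: eq_nf => i j _; rewrite mxE.
- by move=> x N; exact: nf_gen.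
- exact: interp_nf.
Qed.
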